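(* Let $Y$ be a (lower) semilattice and $\{B_\alpha \mid \alpha\in Y\}$ a family of pairwise disjoint skew braces. For each pair $\alpha,\beta\in Y$ with $\alpha\ge\beta$, let $\phi_{\alpha,\beta}:B_\alpha\to B_\beta$ be a skew brace homomorphism such that (1) $\phi_{\alpha,\alpha}$ is the identity automorphism of $B_\alpha$ for every $\alpha\in Y$, and (2) $\phi_{\beta,\gamma}\phi_{\alpha,\beta}=\phi_{\alpha,\gamma}$ for all $\alpha\ge\beta\ge\gamma$ in $Y$. Then $S=\bigcup_{\alpha\in Y}B_\alpha$ endowed with the operations $$a+b:=\phi_{\alpha,\alpha\beta}(a)+\phi_{\beta,\alpha\beta}(b),\qquad a\circ b:=\phi_{\alpha,\alpha\beta}(a)\circ\phi_{\beta,\alpha\beta}(b),$$ for all $a\in B_\alpha$, $b\in B_\beta$, is a dual weak brace with $\mathrm{E}(S)$ isomorphic to $Y$ (it is called the strong semilattice $Y$ of the skew braces $B_\alpha$ and denoted $[Y;B_\alpha;\phi_{\alpha,\beta}]$). Conversely, every dual weak brace is a strong semilattice of skew braces, i.e. is of the form $[Y;B_\alpha;\phi_{\alpha,\beta}]$ for some such $Y$, $B_\alpha$, $\phi_{\alpha,\beta}$.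
   Context: A semigroup is inverse if each $a$ has a unique $a^{-1}$ with $a=aa^{-1}a$, $a^{-1}=a^{-1}aa^{-1}$; an inverse semigroup is Clifford if its idempotents are central. A weak brace is a triple $(S,+,\circ)$ such that $(S,+)$ and $(S,\circ)$ are inverse semigroups and, for all $a,b,c\in S$, $a\circ(b+c)=a\circ b-a+a\circ c$ and $a\circ a^-=-a+a$, where $-a$ and $a^-$ are the inverses of $a$ in $(S,+)$ and $(S,\circ)$. The idempotents of $(S,+)$ and $(S,\circ)$ coincide; their set (a semilattice) is $\mathrm{E}(S)$. A weak brace is dual if $(S,\circ)$ is Clifford ($(S,+)$ is always Clifford). A skew brace is a weak brace with exactly one idempotent, i.e. $(S,+)$ and $(S,\circ)$ are groups with $a\circ(b+c)=a\circ b-a+a\circ c$. A skew brace homomorphism is a map preserving both $+$ and $\circ$. In a (lower) semilattice $Y$ (a commutative idempotent semigroup written multiplicatively), $\alpha\ge\beta$ means $\alpha\beta=\beta$. *)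

(* Defs.v *)
From mathcomp Require Import all_boot.

Set Implicit Arguments.
Unset Strict Implicit.
Unset Printing Implicit Defensive.

Section InverseSemigroups.
Variables (T : Type) (op : T -> T -> T).

Definition inverse_of (a x : T) : Prop :=
  a = op (op a x) a /\ x = op (op x a) x.

Definition inverse_semigroup : Prop :=
  associative op /\ (forall a, exists! x, inverse_of a x).

Definition idempotent_elt (e : T) : Prop := op e e = e.

Definition clifford : Prop :=
  inverse_semigroup /\ (forall e a, idempotent_elt e -> op e a = op a e).

End InverseSemigroups.

(* A triple (S, +, o), with no axiom. *)
Record bimagma : Type := Bimagma {
  bsort :> Type;
  badd : bsort -> bsort -> bsort;
  bcirc : bsort -> bsort -> bsort
}.

Declare Scope brace_scope.
Delimit Scope brace_scope with brace.
Notation "a + b" := (badd a b) : brace_scope.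
Notation "a ∘ b" := (bcirc a b) (at level 40, left associativity) : brace_scope.
Local Open Scope brace_scope.

(* The inverses -a and a^- enter as elements [na] and [ia] characterised by
   [inverse_of]; they exist and are unique by the first two clauses. *)
Definition weak_brace (S : bimagma) : Prop :=
  [/\ inverse_semigroup (@badd S),
      inverse_semigroup (@bcirc S),
      forall a b c na : S, inverse_of (@badd S) a na ->
        a ∘ (b + c) = a ∘ b + na + a ∘ c
    & forall a na ia : S, inverse_of (@badd S) a na ->
        inverse_of (@bcirc S) a ia -> a ∘ ia = na + a].

Definition dual_weak_brace (S : bimagma) : Prop :=
  weak_brace S /\ clifford (@bcirc S).

(* In a weak brace the additive and the multiplicative idempotents coincide,
   so counting the additive ones is enough. *)
Definition skew_brace (S : bimagma) : Prop :=
  weak_brace S /\ exists! e : S, idempotent_elt (@badd S) e.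

Definition brace_hom (A B : bimagma) (f : A -> B) : Prop :=
  {morph f : x y / x + y >-> x + y} /\ {morph f : x y / x ∘ y >-> x ∘ y}.

Definition brace_isomorphic (A B : bimagma) : Prop :=
  exists f : A -> B, brace_hom f /\ bijective f.

Record semilattice : Type := Semilattice {
  slsort :> Type;
  slmul : slsort -> slsort -> slsort;
  slmulA : associative slmul;
  slmulC : commutative slmul;
  slmulxx : idempotent_op slmul
}.

Definition slge (Y : semilattice) (alpha beta : Y) : Prop :=
  slmul alpha beta = beta.

Lemma slge_mull (Y : semilattice) (alpha beta : Y) :
  slge alpha (slmul alpha beta).
Proof. by rewrite /slge slmulA slmulxx. Qed.

Lemma slge_mulr (Y : semilattice) (alpha beta : Y) :
  slge beta (slmul alpha beta).
Proof. by rewrite (slmulC alpha); apply: slge_mull. Qed.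

(* [trans] takes a proof of alpha >= beta, but its value does not depend on
   that proof: [trans_id] and [trans_comp] quantify over all such proofs. *)
Record skew_brace_system (Y : semilattice) : Type := SkewBraceSystem {
  fiber :> Y -> bimagma;
  fiber_skew : forall alpha, skew_brace (fiber alpha);
  trans : forall alpha beta, slge alpha beta -> fiber alpha -> fiber beta;
  trans_hom : forall alpha beta (h : slge alpha beta), brace_hom (trans h);
  trans_id : forall alpha (h : slge alpha alpha) (x : fiber alpha),
    trans h x = x;
  trans_comp : forall alpha beta gamma (hab : slge alpha beta)
      (hbc : slge beta gamma) (hac : slge alpha gamma) (x : fiber alpha),
    trans hbc (trans hab x) = trans hac x
}.

(* [Y; B_alpha; phi_(alpha,beta)].  The union of the pairwise disjoint B_alpha
   is the type of pairs (alpha, a) with a in B_alpha. *)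
Definition strong_semilattice (Y : semilattice) (B : skew_brace_system Y) :
    bimagma :=
  @Bimagma {alpha : Y & B alpha}
    (fun u v => Tagged (fun alpha => bsort (B alpha))
      (trans (slge_mull (tag u) (tag v)) (tagged u)
       + trans (slge_mulr (tag u) (tag v)) (tagged v)))
    (fun u v => Tagged (fun alpha => bsort (B alpha))
      (trans (slge_mull (tag u) (tag v)) (tagged u)
       ∘ trans (slge_mulr (tag u) (tag v)) (tagged v))).

(* f is an isomorphism of Y onto E(S), where E(S) is described, and its product
   computed, both in (S, +) and in (S, o). *)
Definition idempotents_isomorphic (S : bimagma) (Y : semilattice) : Prop :=
  exists f : Y -> S,
    [/\ injective f,
        forall e : S, idempotent_elt (@badd S) e <-> exists alpha, f alpha = e,
        forall e : S, idempotent_elt (@bcirc S) e <-> exists alpha, f alpha = e,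
        {morph f : alpha beta / slmul alpha beta >-> alpha + beta}
      & {morph f : alpha beta / slmul alpha beta >-> alpha ∘ beta}].

(* Main.v *)
(** A weak brace has the same idempotents e for both operations; they satisfy
    e + f = e ∘ f, and (S, +) is Clifford.  If (S, ∘) is Clifford too, then
    a ∘ f = a + f for all a and all idempotents f, so that a |-> a + f preserves
    both operations.  The fibres are B_e = {a | a - a = e}, indexed by the
    semilattice of idempotents, and phi_(e,f) (a) = a + f.  In the other
    direction every identity of a strong semilattice is transported to the
    fibre over the product of the indices involved, where it holds. *)
Require Import Defs.
From mathcomp Require Import all_boot.
From Stdlib Require Import IndefiniteDescription ProofIrrelevance.

Set Implicit Arguments.
Unset Strict Implicit.
Unset Printing Implicit Defensive.

(** * Inverse semigroups and Clifford semigroups *)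

Lemma inverse_semigroup_inv (T : Type) (op : T -> T -> T) :
  inverse_semigroup op ->
  exists inv : T -> T, forall a, inverse_of op a (inv a).
Proof.
case=> _ H; apply: (functional_choice (fun a x => inverse_of op a x)) => a.
by have [x [Hx _]] := H a; exists x.
Qed.

Lemma inverse_of_sym (T : Type) (op : T -> T -> T) (a x : T) :
  inverse_of op a x -> inverse_of op x a.
Proof. by case. Qed.

Section InverseSemigroupTheory.
Variables (T : Type) (op : T -> T -> T) (inv : T -> T).
Hypothesis isg : inverse_semigroup op.
Hypothesis invP : forall a, inverse_of op a (inv a).
Local Notation "a * b" := (op a b).
Local Notation idem := (idempotent_elt op).

Let mA : associative op. Proof. by case: isg. Qed.

Lemma inverse_of_unique a x y : inverse_of op a x -> inverse_of op a y -> x = y.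
Proof. by case: isg => _ /(_ a) [z [_ Hz]] /Hz <- /Hz <-. Qed.

Lemma inverse_of_inv a x : inverse_of op a x -> x = inv a.
Proof. by move=> Hx; apply: inverse_of_unique Hx (invP a). Qed.

Lemma mul_invK a : a * inv a * a = a.
Proof. by case: (invP a) => <-. Qed.

Lemma inv_mulK a : inv a * a * inv a = inv a.
Proof. by case: (invP a) => _ <-. Qed.

Lemma inv_involutive a : inv (inv a) = a.
Proof. by symmetry; apply/inverse_of_inv/inverse_of_sym/invP. Qed.

Lemma idem_mul_inv a : idem (a * inv a).
Proof. by rewrite /idempotent_elt mA mul_invK. Qed.

Lemma idem_inv_mul a : idem (inv a * a).
Proof. by rewrite /idempotent_elt mA inv_mulK. Qed.

Lemma idem_inv e : idem e -> inv e = e.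
Proof. by move=> He; symmetry; apply: inverse_of_inv; split; rewrite !He. Qed.

(* The inverse x of ef equals fxe, which is idempotent; hence ef = x. *)
Lemma idem_mul e f : idem e -> idem f -> idem (e * f).
Proof.
move=> He Hf; set x := inv (e * f).
have x1 : e * f * x * (e * f) = e * f by apply: mul_invK.
have x2 : x * (e * f) * x = x by apply: inv_mulK.
have idx : idem (f * x * e).
  by rewrite /idempotent_elt -[RHS]/(f * x * e) -[in RHS]x2 !mA.
have xE : f * x * e = x.
  apply: inverse_of_inv; split.
    rewrite -[LHS]x1 !mA -(mA e f f) Hf -!mA (mA e e) He //.
  rewrite -[LHS]idx !mA -(mA (f * x) e e) He -(mA (f * x * e) f f) Hf //.
by rewrite -(inv_involutive (e * f)) -/x -xE (idem_inv idx).
Qed.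

(** Being idempotent, [e * f] is its own inverse, and [f * e] is an inverse of it too; uniqueness
    identifies them. *)
Lemma idem_mulC e f : idem e -> idem f -> e * f = f * e.
Proof.
move=> He Hf; have Hef := idem_mul He Hf; have Hfe := idem_mul Hf He.
rewrite -[LHS](idem_inv Hef); symmetry; apply: inverse_of_inv; split.
  by rewrite -[LHS]Hef !mA -(mA e f f) Hf -(mA (e * f) e e) He.
by rewrite -[LHS]Hfe !mA -(mA f e e) He -(mA (f * e) f f) Hf.
Qed.

(** The idempotents [b * inv b] and [inv a * a] commute; swapping them collapses both equations of
    an inverse. *)
Lemma invM a b : inv (a * b) = inv b * inv a.
Proof.
have C := idem_mulC (idem_mul_inv b) (idem_inv_mul a).
symmetry; apply: inverse_of_inv; split; symmetry.
  have -> : a * b * (inv b * inv a) * (a * b)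
      = a * (b * inv b * (inv a * a)) * b by rewrite !mA.
  by rewrite C !mA mul_invK -!mA (mA b) mul_invK.
have -> : inv b * inv a * (a * b) * (inv b * inv a)
    = inv b * (inv a * a * (b * inv b)) * inv a by rewrite !mA.
by rewrite -C !mA inv_mulK -!mA (mA (inv a)) inv_mulK.
Qed.

(** The hypothesis at [e * a] gives [e * a * inv a = inv a * e * a]. Multiplying by [a] on the left
    and commuting idempotents turns this into [a * e = e * a]. *)
Lemma clifford_mul_inv : (forall a, a * inv a = inv a * a) -> clifford op.
Proof.
move=> H; split=> // e a He.
have := H (e * a); rewrite invM (idem_inv He) => E.
have E1 : e * (a * inv a) = inv a * (e * a).
  have C := idem_mulC (idem_mul_inv a) He.
  have -> : e * (a * inv a) = e * a * (inv a * e).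
    by rewrite -[RHS]mA (mA a) C [RHS]mA He.
  by rewrite E -mA (mA e e) He.
have E2 : a * (e * (a * inv a)) = a * (inv a * (e * a)) by rewrite E1.
rewrite H (idem_mulC He (idem_inv_mul a)) !mA mul_invK in E2.
by rewrite E2 (idem_mulC (idem_mul_inv a) He) -[RHS]mA mul_invK.
Qed.

Section Clifford.
Hypothesis central : forall e a, idem e -> e * a = a * e.

Lemma clifford_mulVC a : a * inv a = inv a * a.
Proof.
have E1 : inv a * a * (a * inv a) = inv a * a.
  by rewrite -mA -(central a (idem_mul_inv a)) mul_invK.
have E2 : inv a * a * (a * inv a) = a * inv a.
  by rewrite mA (central a (idem_inv_mul a)) mA mul_invK.
by rewrite -E2 E1.
Qed.

(** The central idempotent [b * inv b] moves past [inv a]. The support [a * inv a] thus grades the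
    semigroup by its idempotents. *)
Lemma clifford_supportM a b :
  a * b * inv (a * b) = a * inv a * (b * inv b).
Proof.
by rewrite invM -mA (mA b) (central (inv a) (idem_mul_inv b)) mA.
Qed.

End Clifford.

Section UniqueIdempotent.
Hypothesis uniq_idem : forall e f, idem e -> idem f -> e = f.

Lemma unique_idem_mull e a : idem e -> e * a = a.
Proof. by move=> He; rewrite (uniq_idem He (idem_mul_inv a)) mul_invK. Qed.

Lemma unique_idem_mulr e a : idem e -> a * e = a.
Proof. by move=> He; rewrite (uniq_idem He (idem_inv_mul a)) mA mul_invK. Qed.

End UniqueIdempotent.

End InverseSemigroupTheory.

(** * Weak braces: common idempotents and the additive Clifford property *)

Section WeakBraceTheory.
Local Open Scope brace_scope.
Variables (S : bimagma) (opp inv : S -> S).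
Hypothesis wb : weak_brace S.
Hypothesis oppP : forall a : S, inverse_of (@badd S) a (opp a).
Hypothesis invP : forall a : S, inverse_of (@bcirc S) a (inv a).
Local Notation idem := (idempotent_elt (@badd S)).

Let isgD : inverse_semigroup (@badd S). Proof. by case: wb. Qed.
Let isgM : inverse_semigroup (@bcirc S). Proof. by case: wb. Qed.
Let dA : associative (@badd S). Proof. by case: isgD. Qed.
Let mA : associative (@bcirc S). Proof. by case: isgM. Qed.

Lemma brace_distr (a b c : S) : a ∘ (b + c) = a ∘ b + opp a + a ∘ c.
Proof. by case: wb => _ _ H _; apply: H (oppP a). Qed.

Lemma circ_inv (a : S) : a ∘ inv a = opp a + a.
Proof. by case: wb => _ _ _ H; apply: H (oppP a) (invP a). Qed.

(** An idempotent of either operation is its own inverse there, so [e ∘ inv e = opp e + e] exhibits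
    it as an idempotent of the other. *)
Lemma idem_circ (e : S) : idem e <-> idempotent_elt (@bcirc S) e.
Proof.
split=> He.
  rewrite -[e in idempotent_elt _ e]He -{1}(idem_inv isgD oppP He) -circ_inv.
  exact: (idem_mul_inv isgM invP).
rewrite -[e in idem e]He -{2}(idem_inv isgM invP He) circ_inv.
exact: (idem_inv_mul isgD oppP).
Qed.

Lemma idem_circM (e f : S) : idem e -> idem f -> idem (e ∘ f).
Proof.
by move=> /idem_circ He /idem_circ Hf; apply/idem_circ/(idem_mul isgM invP).
Qed.

Lemma idem_distr (e b c : S) : idem e -> e ∘ (b + c) = e ∘ b + e + e ∘ c.
Proof. by move=> He; rewrite brace_distr (idem_inv isgD oppP He). Qed.

(** Expanding [e ∘ (f + f)] gives [e ∘ f + e + e ∘ f]; the idempotents commute, which leaves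
    [e + e ∘ f]. *)
Lemma idem_circ_absorb (e f : S) : idem e -> idem f -> e + e ∘ f = e ∘ f.
Proof.
move=> He Hf; have Hef := idem_circM He Hf.
rewrite -[in RHS]Hf idem_distr // (idem_mulC isgD oppP Hef He) -dA.
by rewrite Hef.
Qed.

(** Split [x] as [f + x] with [f = x + opp x]: then [e ∘ x = e ∘ f + e + e ∘ x], and [e ∘ f] absorbs
    [e] by the idempotent case. *)
Lemma circ_absorb (e x : S) : idem e -> e + e ∘ x = e ∘ x.
Proof.
move=> He; have Hf := idem_mul_inv isgD oppP x.
rewrite -(mul_invK oppP x) idem_distr //.
have Hef := idem_circM He Hf.
by rewrite (idem_mulC isgD oppP Hef He) (idem_circ_absorb He Hf) !dA
  (idem_circ_absorb He Hf).
Qed.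

Lemma addNC (a : S) : a + opp a = opp a + a.
Proof.
(* With [e = opp b + b = b ∘ inv b] one has [e ∘ b = b], so [circ_absorb] reads [e + b = b]; add
   [opp b] on the right. *)
have absorb (b : S) : opp b + b + (b + opp b) = b + opp b.
  have := circ_absorb b (idem_inv_mul isgD oppP b).
  by rewrite -circ_inv (mul_invK invP) dA => ->.
(* The instance at [opp a] is the reverse absorption; commuting idempotents then make the two
   equal. *)
have := absorb (opp a); rewrite (inv_involutive isgD oppP) => E.
have C := idem_mulC isgD oppP (idem_mul_inv isgD oppP a)
  (idem_inv_mul isgD oppP a).
by rewrite -[RHS]E C absorb.
Qed.

Lemma weak_brace_add_clifford : clifford (@badd S).
Proof. exact: (clifford_mul_inv isgD oppP) addNC. Qed.

(* With g = e + f one gets e ∘ g = f ∘ g = e ∘ f, and g = g ∘ (e + f). *)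
Lemma idem_addE (e f : S) : idem e -> idem f -> e + f = e ∘ f.
Proof.
move=> He Hf; have Hg : idem (e + f) by apply: (idem_mul isgD oppP).
have mC x y : idem x -> idem y -> x ∘ y = y ∘ x.
  by move=> /idem_circ Hx /idem_circ Hy; apply: (idem_mulC isgM invP).
have Hee : e ∘ e = e by apply/idem_circ.
have Hff : f ∘ f = f by apply/idem_circ.
have E1 : (e + f) ∘ e = e ∘ f.
  by rewrite mC // idem_distr // Hee He idem_circ_absorb.
have Hfe := idem_circM Hf He.
have E2 : (e + f) ∘ f = e ∘ f.
  rewrite mC // idem_distr // Hff -dA Hf (idem_mulC isgD oppP Hfe Hf).
  by rewrite idem_circ_absorb // mC.
have Hef := idem_circM He Hf.
have Hgg : (e + f) ∘ (e + f) = e + f by apply/idem_circ.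
have := idem_distr e f Hg; rewrite Hgg E1 E2 => E.
have A : (e + f) + e ∘ f = e ∘ f by rewrite -E1 circ_absorb.
by rewrite E -dA A Hef.
Qed.

Lemma add_support (a : S) : a + (a + opp a) = a.
Proof. by rewrite addNC dA (mul_invK oppP). Qed.

(** * Dual weak braces: supports and translation by idempotents *)

Section Dual.
Hypothesis cliffM : forall e a : S,
  idempotent_elt (@bcirc S) e -> e ∘ a = a ∘ e.

Let cliffD : forall e a : S, idem e -> e + a = a + e.
Proof. by case: weak_brace_add_clifford. Qed.

Lemma support_circE (a : S) : a ∘ inv a = a + opp a.
Proof. by rewrite circ_inv addNC. Qed.

Lemma support_add (a b : S) :
  a + b + opp (a + b) = (a + opp a) + (b + opp b).
Proof. exact: (clifford_supportM isgD oppP cliffD). Qed.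

(** The two operations have the same supports, so the Clifford law for [∘] applies, and [idem_addE]
    turns the product of supports into a sum. Hence both operations respect one grading. *)
Lemma support_circ (a b : S) :
  a ∘ b + opp (a ∘ b) = (a + opp a) + (b + opp b).
Proof.
rewrite -support_circE (clifford_supportM isgM invP cliffM) !support_circE.
by rewrite -(idem_addE (idem_mul_inv isgD oppP a) (idem_mul_inv isgD oppP b)).
Qed.

Lemma support_idem (e : S) : idem e -> e + opp e = e.
Proof. by move=> He; rewrite (idem_inv isgD oppP). Qed.

Lemma support_opp (a : S) : opp a + opp (opp a) = a + opp a.
Proof. by rewrite (inv_involutive isgD oppP) addNC. Qed.

Lemma support_inv (a : S) : inv a + opp (inv a) = a + opp a.
Proof.
rewrite -!support_circE (inv_involutive isgM invP).
by rewrite (clifford_mulVC isgM invP cliffM).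
Qed.

(* Expand x = a ∘ f as a ∘ (f + f) = x - a + x and cancel x on both sides. *)
Lemma circ_idem (a f : S) : idem f -> a ∘ f = a + f.
Proof.
move=> Hf.
have := brace_distr a f f; rewrite [f + f]Hf; set x := a ∘ f => E.
have Hx : x + opp x = a + opp a + f.
  by rewrite support_circ (support_idem Hf).
set g := x + opp x in Hx.
have Hg : idem g by apply: (idem_mul_inv isgD oppP).
have Eo : opp x = g + opp a.
  have -> : opp x = opp x + (x + opp a + x) + opp x.
    by rewrite -E (inv_mulK oppP).
  have -> : opp x + (x + opp a + x) + opp x
      = (opp x + x) + opp a + (x + opp x) by rewrite !dA.
  by rewrite -addNC -/g -dA -(cliffD (opp a) Hg) dA Hg.
rewrite -(inv_involutive isgD oppP x) Eo (invM isgD oppP).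
rewrite (inv_involutive isgD oppP) (idem_inv isgD oppP Hg) Hx.
by rewrite dA add_support.
Qed.

Lemma addD_idem (a b f : S) : idem f -> a + b + f = (a + f) + (b + f).
Proof.
by move=> Hf; rewrite -[RHS]dA (cliffD _ Hf) -(dA b) [f + f]Hf dA.
Qed.

(** By [circ_idem], adding [f] is multiplying by [f], which is central and idempotent for [∘]. *)
Lemma circD_idem (a b f : S) : idem f -> a ∘ b + f = (a + f) ∘ (b + f).
Proof.
move=> Hf; have Hm : idempotent_elt (@bcirc S) f by apply/idem_circ.
rewrite -!circ_idem //.
by rewrite -[RHS]mA (cliffM _ Hm) -(mA b) [f ∘ f]Hm mA.
Qed.

End Dual.
End WeakBraceTheory.

(** * Weak brace axioms inherited along an injective homomorphism *)

Section SubBrace.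
Local Open Scope brace_scope.
Variables (S A : bimagma) (i : A -> S) (opp inv : S -> S) (oppA invA : A -> A).
Hypothesis i_inj : injective i.
Hypothesis i_hom : brace_hom i.
Hypothesis wb : weak_brace S.
Hypothesis oppP : forall a : S, inverse_of (@badd S) a (opp a).
Hypothesis invP : forall a : S, inverse_of (@bcirc S) a (inv a).
Hypothesis oppE : {morph i : x / oppA x >-> opp x}.
Hypothesis invE : {morph i : x / invA x >-> inv x}.

(** Closure under inverses gives existence; images of inverses are inverses in [S], so uniqueness
    descends by injectivity. *)
Lemma inverse_semigroup_sub (op : S -> S -> S) (opA : A -> A -> A)
    (v : S -> S) (vA : A -> A) :
  inverse_semigroup op -> (forall a, inverse_of op a (v a)) ->
  {morph i : x y / opA x y >-> op x y} -> {morph i : x / vA x >-> v x} ->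
  inverse_semigroup opA.
Proof.
move=> isg vP opE vE; have [oA _] := isg; split=> [x y z | x].
  by apply: i_inj; rewrite !opE oA.
exists (vA x); split=> [|y [y1 y2]].
  by split; apply: i_inj; rewrite !opE vE; case: (vP (i x)).
apply: i_inj; rewrite vE; symmetry; apply: (inverse_of_inv isg vP).
by split; rewrite -!opE -?y1 -?y2.
Qed.

Lemma inverse_of_sub (op : S -> S -> S) (opA : A -> A -> A) (x y : A) :
  {morph i : x y / opA x y >-> op x y} ->
  inverse_of opA x y -> inverse_of op (i x) (i y).
Proof. by move=> opE [y1 y2]; split; rewrite -!opE -?y1 -?y2. Qed.

Lemma weak_brace_sub : weak_brace A.
Proof.
have [iD iM] := i_hom; have [isgD isgM distr inve] := wb; split.
- exact: (inverse_semigroup_sub isgD oppP iD oppE).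
- exact: (inverse_semigroup_sub isgM invP iM invE).
- move=> a b c na /(inverse_of_sub iD) Hna.
  by apply: i_inj; rewrite iM !iD !iM (distr _ _ _ _ Hna).
move=> a na ia /(inverse_of_sub iD) Hna /(inverse_of_sub iM) Hia.
by apply: i_inj; rewrite iM iD (inve _ _ _ Hna Hia).
Qed.

End SubBrace.

Lemma sval_inj (T : Type) (P : T -> Prop) : injective (@proj1_sig T P).
Proof.
by move=> [x px] [y py] /= E; subst y; rewrite (proof_irrelevance _ px py).
Qed.

(** * Decomposition of a dual weak brace into skew braces *)

Section Decomposition.
Local Open Scope brace_scope.
Variables (S : bimagma) (opp inv : S -> S).
Hypothesis wb : weak_brace S.
Hypothesis oppP : forall a : S, inverse_of (@badd S) a (opp a).
Hypothesis invP : forall a : S, inverse_of (@bcirc S) a (inv a).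
Hypothesis cliffM : forall e a : S,
  idempotent_elt (@bcirc S) e -> e ∘ a = a ∘ e.
Local Notation idem := (idempotent_elt (@badd S)).

Let isgD : inverse_semigroup (@badd S). Proof. by case: wb. Qed.
Let dA : associative (@badd S). Proof. by case: isgD. Qed.

Definition idem_slmul (e f : {e : S | idem e}) : {e : S | idem e} :=
  exist _ (sval e + sval f) (idem_mul isgD oppP (proj2_sig e) (proj2_sig f)).

Lemma idem_slmulA : associative idem_slmul.
Proof. by move=> e f g; apply: sval_inj; apply: dA. Qed.

Lemma idem_slmulC : commutative idem_slmul.
Proof.
move=> e f; apply: sval_inj.
exact: (idem_mulC isgD oppP (proj2_sig e) (proj2_sig f)).
Qed.

Lemma idem_slmulxx : idempotent_op idem_slmul.
Proof. by move=> e; apply: sval_inj; apply: (proj2_sig e). Qed.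

Definition idem_semilattice : semilattice :=
  Semilattice idem_slmulA idem_slmulC idem_slmulxx.

(** For idempotent [e] this is the maximal subgroup with identity [e], for [+] and, the supports
    being the same, for [∘] as well. *)
Definition support_fiber (e : S) : Type := {a : S | a + opp a = e}.

Section Fiber.
Variable e : S.
Hypothesis He : idem e.

Lemma support_fiber_add (a b : support_fiber e) :
  sval a + sval b + opp (sval a + sval b) = e.
Proof.
by rewrite (support_add wb oppP invP) (proj2_sig a) (proj2_sig b) He.
Qed.

Lemma support_fiber_circ (a b : support_fiber e) :
  sval a ∘ sval b + opp (sval a ∘ sval b) = e.
Proof.
by rewrite (support_circ wb oppP invP cliffM) (proj2_sig a) (proj2_sig b) He.
Qed.

Definition support_brace : bimagma :=
  @Bimagma (support_fiber e)
    (fun a b => exist _ (sval a + sval b) (support_fiber_add a b))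
    (fun a b => exist _ (sval a ∘ sval b) (support_fiber_circ a b)).

Lemma support_brace_skew : skew_brace support_brace.
Proof.
split.
  pose oppA (a : support_brace) : support_brace :=
    exist _ (opp (sval a))
      (etrans (support_opp wb oppP invP (sval a)) (proj2_sig a)).
  pose invA (a : support_brace) : support_brace :=
    exist _ (inv (sval a))
      (etrans (support_inv wb oppP invP cliffM (sval a)) (proj2_sig a)).
  by apply: (@weak_brace_sub S support_brace (@proj1_sig _ _) opp inv oppA invA)
    => //; apply: sval_inj.
exists (exist _ e (support_idem wb oppP He) : support_brace); split.
  by apply: sval_inj.
(* An idempotent is its own support, so in this fibre it can only be [e]. *)
move=> [a Ha] /(congr1 (@proj1_sig _ _)) /= Ia; apply: sval_inj => /=.
by rewrite -Ha (support_idem wb oppP Ia).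
Qed.

End Fiber.

Lemma support_trans_subproof (e f : idem_semilattice) (h : slge e f)
    (a : support_fiber (sval e)) :
  sval a + sval f + opp (sval a + sval f) = sval f.
Proof.
rewrite (support_add wb oppP invP) (proj2_sig a).
rewrite (support_idem wb oppP (proj2_sig f)).
exact: (congr1 (@proj1_sig _ _) h).
Qed.

Definition support_trans (e f : idem_semilattice) (h : slge e f)
    (a : support_brace (proj2_sig e)) : support_brace (proj2_sig f) :=
  exist _ (sval a + sval f) (support_trans_subproof h a).

Lemma support_trans_hom (e f : idem_semilattice) (h : slge e f) :
  brace_hom (support_trans h).
Proof.
split=> a b; apply: sval_inj => /=.
  exact: (addD_idem wb oppP invP _ _ (proj2_sig f)).
exact: (circD_idem wb oppP invP cliffM _ _ (proj2_sig f)).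
Qed.

Lemma support_trans_id (e : idem_semilattice) (h : slge e e)
    (a : support_brace (proj2_sig e)) : support_trans h a = a.
Proof.
apply: sval_inj => /=; case: a => a /= <-; exact: (add_support wb oppP invP).
Qed.

Lemma support_trans_comp (e f g : idem_semilattice) (hef : slge e f)
    (hfg : slge f g) (heg : slge e g) (a : support_brace (proj2_sig e)) :
  support_trans hfg (support_trans hef a) = support_trans heg a.
Proof.
apply: sval_inj => /=; rewrite -dA; congr (_ + _).
exact: (congr1 (@proj1_sig _ _) hfg).
Qed.

Definition support_system : skew_brace_system idem_semilattice :=
  SkewBraceSystem (fun e : idem_semilattice => support_brace_skew (proj2_sig e))
    support_trans_hom support_trans_id support_trans_comp.

Lemma support_system_iso :
  brace_isomorphic (strong_semilattice support_system) S.
Proof.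
pose F (u : strong_semilattice support_system) : S := sval (tagged u).
pose sup (a : S) : idem_semilattice := exist _ _ (idem_mul_inv isgD oppP a).
pose H (a : S) : strong_semilattice support_system :=
  Tagged (fun e => bsort (support_system e))
    (exist _ a (erefl _) : support_system (sup a)).
exists F; split.
  split=> -[e [a Ha]] -[f [b Hb]]; rewrite /F /=;
      have Hef := proj2_sig (@slmul idem_semilattice e f).
    (* The two translations by [e + f] merge into one of [a + b], which absorbs its own support
       [e + f]. *)
    rewrite -(addD_idem wb oppP invP _ _ Hef) /= -Ha -Hb.
    by rewrite -(support_add wb oppP invP) (add_support wb oppP invP).
  rewrite -(circD_idem wb oppP invP cliffM _ _ Hef) /=.
  rewrite -Ha -Hb -(support_circ wb oppP invP cliffM).
  exact: (add_support wb oppP invP).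
exists H => [[[e He] [a Ha]] | a] //.
(* The fibre condition replaces the index [e] by [a + opp a]; two proofs of its idempotency remain
   to be identified. *)
rewrite /H /F /=; simpl in Ha; subst e.
by rewrite /sup (proof_irrelevance _ He (idem_mul_inv isgD oppP a)).
Qed.

End Decomposition.

(** * Strong semilattices of semigroups, for a single operation *)

Section StrongSemilatticeOperation.
Variables (Y : semilattice) (G : Y -> Type).
Variable phi : forall a b : Y, slge a b -> G a -> G b.
Hypothesis phi_id : forall a (h : slge a a) (x : G a), phi h x = x.
Hypothesis phi_comp : forall a b c (hab : slge a b) (hbc : slge b c)
  (hac : slge a c) (x : G a), phi hbc (phi hab x) = phi hac x.

Lemma slge_refl (a : Y) : slge a a.
Proof. exact: slmulxx. Qed.

Lemma slge_trans (a b c : Y) : slge a b -> slge b c -> slge a c.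
Proof. by rewrite /slge => hab <-; rewrite slmulA hab. Qed.

Lemma phi_irr a b (h h' : slge a b) (x : G a) : phi h x = phi h' x.
Proof. by rewrite -(phi_comp h (slge_refl b) h') phi_id. Qed.

Lemma phi_congr (u v : {a : Y & G a}) c (h : slge (tag u) c)
    (h' : slge (tag v) c) :
  u = v -> phi h (tagged u) = phi h' (tagged v).
Proof. by move=> E; subst v; apply: phi_irr. Qed.

(* Comparing images under phi in a common fibre avoids casts along equalities
   of indices. *)
Lemma eq_phi (u v : {a : Y & G a}) :
  tag u = tag v ->
  (forall c (h : slge (tag u) c) (h' : slge (tag v) c),
     phi h (tagged u) = phi h' (tagged v)) -> u = v.
Proof.
case: u v => a x [b y] /= E; subst b.
by move/(_ a (slge_refl a) (slge_refl a)); rewrite !phi_id => ->.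
Qed.

(** Pushing along a reflexive comparison, where [phi] is the identity, recovers the components
    without a cast between fibres. *)
Lemma Tagged_phi_inj a (x y : G a) :
  Tagged (fun a => G a) x = Tagged (fun a => G a) y -> x = y.
Proof.
move=> /(@phi_congr (Tagged (fun a => G a) x) (Tagged (fun a => G a) y) a
  (slge_refl a) (slge_refl a)).
by rewrite !phi_id.
Qed.

Variable m : forall a, G a -> G a -> G a.
Hypothesis phi_morph : forall a b (h : slge a b),
  {morph @phi a b h : x y / m x y >-> m x y}.

(** With [m] the sum or the circle product this unfolds to the operation of [strong_semilattice], so
    what follows serves both. *)
Definition strong_op (u v : {a : Y & G a}) : {a : Y & G a} :=
  Tagged (fun a => G a) (m (phi (slge_mull (tag u) (tag v)) (tagged u))
                           (phi (slge_mulr (tag u) (tag v)) (tagged v))).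

(** Functoriality of [phi] lets nested products be evaluated in one fibre. The comparison proofs are
    arbitrary, so that both sides of an identity can share them. *)
Lemma phi_strong_op (u v : {a : Y & G a}) c
    (h : slge (slmul (tag u) (tag v)) c) (hu : slge (tag u) c)
    (hv : slge (tag v) c) :
  phi h (tagged (strong_op u v)) = m (phi hu (tagged u)) (phi hv (tagged v)).
Proof. by rewrite phi_morph !(phi_comp _ _ hu, phi_comp _ _ hv). Qed.

(** The left side lives over [slmul a a], only provably equal to [a]; hence the detour through
    [eq_phi]. *)
Lemma strong_op_fiber a (x y : G a) :
  strong_op (Tagged (fun a => G a) x) (Tagged (fun a => G a) y)
  = Tagged (fun a => G a) (m x y).
Proof.
apply: eq_phi => [|c h h']; first exact: slmulxx.
by rewrite (@phi_strong_op (Tagged _ x) (Tagged _ y) c h h' h') phi_morph.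
Qed.

Lemma strong_op_assoc :
  (forall a, associative (@m a)) -> associative strong_op.
Proof.
move=> mA u v w; apply: eq_phi => [|c h h']; first exact: slmulA.
have hu := slge_trans (slge_mull _ _) h.
have hvw := slge_trans (slge_mulr _ _) h.
have hv := slge_trans (slge_mull _ _) hvw.
have hw := slge_trans (slge_mulr _ _) hvw.
have huv := slge_trans (slge_mull _ _) h'.
by rewrite (phi_strong_op h hu hvw) (phi_strong_op hvw hv hw)
  (phi_strong_op h' huv hw) (phi_strong_op huv hu hv) mA.
Qed.

Lemma inverse_of_strong_op a (x y : G a) :
  inverse_of strong_op (Tagged (fun a => G a) x) (Tagged (fun a => G a) y) <->
  inverse_of (@m a) x y.
Proof.
rewrite /inverse_of !strong_op_fiber.
split=> [[/Tagged_phi_inj <- /Tagged_phi_inj <-] // | [<- <-]] //.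
Qed.

(** On indices the two equations of an inverse read [a = slmul a b] and [b = slmul b a], hence
    [a = b]. *)
Lemma inverse_of_strong_op_fiber a (x : G a) (v : {a : Y & G a}) :
  inverse_of strong_op (Tagged (fun a => G a) x) v ->
  exists y : G a, v = Tagged (fun a => G a) y /\ inverse_of (@m a) x y.
Proof.
case: v => b y Hv; have [/(congr1 tag) /= E1 /(congr1 tag) /= E2] := Hv.
have absorb (i j : Y) : slmul (slmul i j) i = slmul i j.
  by rewrite slmulC slmulA slmulxx.
rewrite absorb in E1; rewrite absorb slmulC -E1 in E2.
by subst b; exists y; split=> //; apply/inverse_of_strong_op.
Qed.

Lemma idempotent_strong_op a (x : G a) :
  idempotent_elt strong_op (Tagged (fun a => G a) x) <->
  idempotent_elt (@m a) x.
Proof.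
rewrite /idempotent_elt strong_op_fiber.
by split=> [/Tagged_phi_inj | ->].
Qed.

Hypothesis isg : forall a, inverse_semigroup (@m a).
Hypothesis uniq_idem : forall a (e f : G a),
  idempotent_elt (@m a) e -> idempotent_elt (@m a) f -> e = f.

Lemma strong_op_inverse_semigroup : inverse_semigroup strong_op.
Proof.
split=> [|[a x]]; first by apply: strong_op_assoc => a; case: (isg a).
have [_ /(_ x) [y [Hy Uy]]] := isg a.
exists (Tagged (fun a => G a) y); split; first exact/inverse_of_strong_op.
by move=> v /inverse_of_strong_op_fiber [z [-> /Uy ->]].
Qed.

(** Pushed to a lower fibre, an idempotent stays idempotent; being the only one there, it is a
    two-sided identity and commutes with everything. *)
Lemma strong_op_clifford : clifford strong_op.
Proof.
split=> [|[a e] [b x] /idempotent_strong_op He].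
  exact: strong_op_inverse_semigroup.
apply: eq_phi => [|c h h']; first exact: slmulC.
have ha := slge_trans (slge_mull _ _) h.
have hb := slge_trans (slge_mulr _ _) h.
rewrite (phi_strong_op h ha hb) (phi_strong_op h' hb ha) /=.
have Hphi : idempotent_elt (@m c) (phi ha e).
  by rewrite /idempotent_elt -phi_morph He.
have [inv invP] := inverse_semigroup_inv (isg c).
rewrite (unique_idem_mull (isg c) invP (@uniq_idem c) _ Hphi).
by rewrite (unique_idem_mulr (isg c) invP (@uniq_idem c) _ Hphi).
Qed.

End StrongSemilatticeOperation.

Lemma skew_brace_idem_add (B : bimagma) (e f : B) :
  skew_brace B -> idempotent_elt (@badd B) e -> idempotent_elt (@badd B) f ->
  e = f.
Proof. by case=> _ [g [_ Hg]] /Hg <- /Hg <-. Qed.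

Lemma weak_brace_idem (B : bimagma) (e : B) :
  weak_brace B ->
  idempotent_elt (@badd B) e <-> idempotent_elt (@bcirc B) e.
Proof.
move=> wb; have [isgD isgM _ _] := wb.
have [opp oppP] := inverse_semigroup_inv isgD.
have [inv invP] := inverse_semigroup_inv isgM.
exact: (idem_circ wb oppP invP).
Qed.

(** * Strong semilattices of skew braces as dual weak braces *)

Section StrongSemilattice.
Local Open Scope brace_scope.
Variables (Y : semilattice) (B : skew_brace_system Y).
Local Notation S := (strong_semilattice B).

Let wbB a : weak_brace (B a). Proof. by case: (fiber_skew B a). Qed.
Let isgD a : inverse_semigroup (@badd (B a)). Proof. by case: (wbB a). Qed.
Let isgM a : inverse_semigroup (@bcirc (B a)). Proof. by case: (wbB a). Qed.
Let trD a b (h : slge a b) :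
  {morph @trans Y B a b h : x y / x + y >-> x + y}.
Proof. by case: (trans_hom B h). Qed.
Let trM a b (h : slge a b) :
  {morph @trans Y B a b h : x y / x ∘ y >-> x ∘ y}.
Proof. by case: (trans_hom B h). Qed.
Let uniqD a (e f : B a) : idempotent_elt (@badd (B a)) e ->
  idempotent_elt (@badd (B a)) f -> e = f.
Proof. exact/skew_brace_idem_add/fiber_skew. Qed.
Let uniqM a (e f : B a) : idempotent_elt (@bcirc (B a)) e ->
  idempotent_elt (@bcirc (B a)) f -> e = f.
Proof.
move=> /(weak_brace_idem _ (wbB a)) He /(weak_brace_idem _ (wbB a)).
exact: uniqD.
Qed.

Let phiD := phi_strong_op (@trans_comp Y B) trD.
Let phiM := phi_strong_op (@trans_comp Y B) trM.

(** The opposite of [a] lies in the fibre of [a], so both sides have the same index, and below it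
    the identity is the law of one skew brace. *)
Lemma strong_semilattice_distr (a b c na : S) :
  inverse_of (@badd S) a na -> a ∘ (b + c) = a ∘ b + na + a ∘ c.
Proof.
case: a => i x.
move=> /(inverse_of_strong_op_fiber (@trans_id Y B) (@trans_comp Y B) trD).
move=> -[y [-> Hy]].
apply: (eq_phi (@trans_id Y B)) => [|d h h'].
  (* With j and k the indices of [b] and [c], this is i(jk) = ((ij)i)(ik). *)
  rewrite /= -(slmulA (slmul i _)) (slmulA i i) slmulxx !slmulA.
  by rewrite (slmulC (slmul i _) i) !slmulA slmulxx.
have hi := slge_trans (slge_mull _ _) h.
have hbc := slge_trans (slge_mulr _ _) h.
have hb := slge_trans (slge_mull _ _) hbc.
have hc := slge_trans (slge_mulr _ _) hbc.
have hl := slge_trans (slge_mull _ _) h'.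
have hr := slge_trans (slge_mulr _ _) h'.
have hib := slge_trans (slge_mull _ _) hl.
rewrite (phiM h hi hbc) (phiD hbc hb hc) (phiD h' hl hr) (phiM hr hi hc).
rewrite (phiD hl hib hi) (phiM hib hi hb).
have [_ _ distr _] := wbB d; apply: distr.
(* The transition map carries the inverse [y] of [x] to an inverse of the image of [x]. *)
by case: Hy => y1 y2; split; rewrite -!trD -?y1 -?y2.
Qed.

Lemma strong_semilattice_circ_inv (a na ia : S) :
  inverse_of (@badd S) a na -> inverse_of (@bcirc S) a ia -> a ∘ ia = na + a.
Proof.
case: a => i x.
move=> /(inverse_of_strong_op_fiber (@trans_id Y B) (@trans_comp Y B) trD).
move=> -[y [-> Hy]].
move=> /(inverse_of_strong_op_fiber (@trans_id Y B) (@trans_comp Y B) trM).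
move=> -[z [-> Hz]].
rewrite [LHS](strong_op_fiber (@trans_id Y B) (@trans_comp Y B) trM).
rewrite [RHS](strong_op_fiber (@trans_id Y B) (@trans_comp Y B) trD).
by have [_ _ _ circ_inv] := wbB i; rewrite (circ_inv _ _ _ Hy Hz).
Qed.

Lemma strong_semilattice_dual : dual_weak_brace S.
Proof.
have cD := strong_op_clifford (@trans_id Y B) (@trans_comp Y B) trD isgD uniqD.
have cM := strong_op_clifford (@trans_id Y B) (@trans_comp Y B) trM isgM uniqM.
split=> //; split; [by case: cD | by case: cM | |].
  exact: strong_semilattice_distr.
exact: strong_semilattice_circ_inv.
Qed.

Lemma strong_semilattice_idempotents : idempotents_isomorphic S Y.
Proof.
have ex a : exists e : B a, idempotent_elt (@badd (B a)) e.
  by have [_ [e [He _]]] := fiber_skew B a; exists e.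
(* Description turns the idempotents, known only to exist, into a function of the index. *)
pose e a : B a := sval (constructive_indefinite_description _ (ex a)).
have eD a : idempotent_elt (@badd (B a)) (e a).
  exact: (proj2_sig (constructive_indefinite_description _ (ex a))).
have eM a : idempotent_elt (@bcirc (B a)) (e a) by apply/weak_brace_idem.
(* Homomorphisms preserve idempotents and each fibre has only one; this makes the chosen idempotents
   multiply as their indices do. *)
have trE a b (h : slge a b) : trans h (e a) = e b.
  by apply: uniqD => //; rewrite /idempotent_elt -trD eD.
exists (fun a => Tagged (fun a => bsort (B a)) (e a)); split.
- by move=> a b /(congr1 tag).
- case=> a x; split.
    move=> /(idempotent_strong_op (@trans_id Y B) (@trans_comp Y B) trD) Hx.
    by exists a; rewrite (uniqD (eD a) Hx).
  move=> [b <-].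
  exact/(idempotent_strong_op (@trans_id Y B) (@trans_comp Y B) trD).
- case=> a x; split.
    move=> /(idempotent_strong_op (@trans_id Y B) (@trans_comp Y B) trM) Hx.
    by exists a; rewrite (uniqM (eM a) Hx).
  move=> [b <-].
  exact/(idempotent_strong_op (@trans_id Y B) (@trans_comp Y B) trM).
- by move=> a b /=; rewrite !trE [_ + _]eD.
by move=> a b /=; rewrite !trE [_ ∘ _]eM.
Qed.

End StrongSemilattice.

Theorem theorem2p1 :
  (forall (Y : semilattice) (B : skew_brace_system Y),
     dual_weak_brace (strong_semilattice B) /\
     idempotents_isomorphic (strong_semilattice B) Y) /\
  (forall S : bimagma, dual_weak_brace S ->
     exists (Y : semilattice) (B : skew_brace_system Y),
       brace_isomorphic (strong_semilattice B) S).
Proof.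
split=> [Y B | S [wb [_ cliffM]]].
  split; first exact: strong_semilattice_dual.
  exact: strong_semilattice_idempotents.
have [isgD isgM _ _] := wb.
have [opp oppP] := inverse_semigroup_inv isgD.
have [inv invP] := inverse_semigroup_inv isgM.
by exists (idem_semilattice wb oppP), (support_system wb oppP invP cliffM);
  apply: support_system_iso.
Qed.
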